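(* Let $f$ satisfy $(\mathcal A)$ and let $p\ge1$. Let $y_0\in\mathcal H$ and define recursively for $k\ge0$ $$\lambda_k=\|\nabla f(y_k)\|^{-\frac{p-1}{p}},\qquad y_{k+1}=\operatorname{prox}_{\lambda_k f}(y_k),$$ and assume $\nabla f(y_k)\neq0$ for all $k\ge0$. Then $f(y_{k+1})-\inf_{\mathcal H}f=o\big(k^{-(2-\frac1p)}\big)$ as $k\to+\infty$, and $(y_k)_{k\ge0}$ converges weakly to an element of $S=\operatorname{argmin} f$.
   Context: $\mathcal H$ is a real Hilbert space. Assumption $(\mathcal A)$: $f:\mathcal H\to\mathbb R$ is convex and continuously differentiable, $S=\operatorname{argmin}_{\mathcal H} f\neq\emptyset$, and $\nabla f$ is Lipschitz continuous on bounded subsets of $\mathcal H$. For $\lambda>0$, $\operatorname{prox}_{\lambda f}(y)=\operatorname{argmin}_{u\in\mathcal H}\{f(u)+\frac{1}{2\lambda}\|u-y\|^2\}$. *)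

(* Defs.v *)
From HB Require Import structures.
From mathcomp Require Import all_boot all_order all_algebra.
From mathcomp Require Import all_classical all_reals all_analysis.
Set Implicit Arguments. Unset Strict Implicit. Unset Printing Implicit Defensive.
Import Order.TTheory GRing.Theory Num.Theory.
Import numFieldNormedType.Exports.
Local Open Scope classical_set_scope.
Local Open Scope ring_scope.

(* A real inner product on a normed space H whose norm is induced by it.
   Together with H : completeNormedModType R this makes (H, ip) a real
   Hilbert space. *)
Definition is_inner_product (R : realType) (H : normedModType R)
    (ip : H -> H -> R) : Prop :=
  [/\ forall x y, ip x y = ip y x,
      forall (a : R) x y z, ip (a *: x + y) z = a * ip x z + ip y z &
      forall x, ip x x = `|x| ^+ 2].

Definition convex_fun (R : realType) (H : normedModType R) (f : H -> R) : Prop :=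
  forall (t : R) (x y : H), 0 <= t -> t <= 1 ->
    f (t *: x + (1 - t) *: y) <= t * f x + (1 - t) * f y.

Definition is_gradient (R : realType) (H : normedModType R)
    (ip : H -> H -> R) (f : H -> R) (g : H -> H) : Prop :=
  forall x, differentiable f x /\ forall v, 'd f x v = ip (g x) v.

Definition lipschitz_on_bounded (R : realType) (H : normedModType R)
    (g : H -> H) : Prop :=
  forall r : R, exists L : R, forall x y : H,
    `|x| <= r -> `|y| <= r -> `|g x - g y| <= L * `|x - y|.

Definition is_argmin (R : realType) (H : normedModType R) (f : H -> R) (x : H)
  : Prop := forall u, f x <= f u.

Definition is_prox (R : realType) (H : normedModType R) (f : H -> R)
    (lam : R) (y z : H) : Prop :=
  forall u, f z + (2 * lam)^-1 * `|z - y| ^+ 2 <= f u + (2 * lam)^-1 * `|u - y| ^+ 2.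

(* Main.v *)
(* Writing [z = y - lam g z] for a proximal step, convexity makes [f (y k)],
   [|g (y k)|] and [|y k - x|] (for every minimizer [x]) nonincreasing, so the
   step sizes [lam k] are bounded below by [l := lam 0].  The energy
   [|y k - x|^2 + 2 k l (f (y k) - f x) + (k l |g (y k)|)^2] is then
   nonincreasing, whence [|g (y k)| = O(1/k)] and [lam k >= c k^a] with
   [a = 1 - 1/p].  As [lam k (f (y k.+1) - f x)] is dominated by the telescoping
   [|y k - x|^2 - |y k.+1 - x|^2], summing over the block [m, 2m) gives
   [f (y (2 m)) - f x = o(m^-(1 + a))].
   Weak convergence is Opial's argument, with weak compactness replaced by
   points lying in all closed convex hulls of tails. *)
Require Import Defs.
From HB Require Import structures.
From mathcomp Require Import all_boot all_order all_algebra.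
From mathcomp Require Import all_classical all_reals all_analysis.
From mathcomp Require Import ring lra zify.
Import Order.TTheory GRing.Theory Num.Theory.
Import numFieldNormedType.Exports.
Set Implicit Arguments. Unset Strict Implicit. Unset Printing Implicit Defensive.
Local Open Scope classical_set_scope.
Local Open Scope ring_scope.

(** * Algebra and continuity of the inner product *)

Lemma inner_productDl (R : realType) (H : normedModType R) (ip : H -> H -> R) :
  is_inner_product ip -> forall x y z, ip (x + y) z = ip x z + ip y z.
Proof. by move=> [_ lin _] x y z; rewrite -{1}[x]scale1r lin mul1r. Qed.

Lemma inner_productZl (R : realType) (H : normedModType R) (ip : H -> H -> R) :
  is_inner_product ip -> forall a x z, ip (a *: x) z = a * ip x z.
Proof.
move=> hip a x z; have D := inner_productDl hip.
have ip0 : ip 0 z = 0 by have := D 0 0 z; rewrite addr0; lra.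
by case: hip => [_ lin _]; rewrite -[a *: x]addr0 lin ip0 addr0.
Qed.

Lemma inner_productBl (R : realType) (H : normedModType R) (ip : H -> H -> R) :
  is_inner_product ip -> forall x y z, ip (x - y) z = ip x z - ip y z.
Proof.
move=> hip x y z.
by rewrite (inner_productDl hip) -scaleN1r (inner_productZl hip) mulN1r.
Qed.

Lemma sqr_normD (R : realType) (H : normedModType R) (ip : H -> H -> R) :
  is_inner_product ip ->
  forall x y, `|x + y| ^+ 2 = `|x| ^+ 2 + 2 * ip x y + `|y| ^+ 2.
Proof.
move=> hip x y; have [sym _ nrm] := hip; have D := inner_productDl hip.
by rewrite -!nrm D sym [ip y _]sym !D (sym y x); ring.
Qed.

Lemma sqr_normB (R : realType) (H : normedModType R) (ip : H -> H -> R) :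
  is_inner_product ip ->
  forall x y, `|x - y| ^+ 2 = `|x| ^+ 2 - 2 * ip x y + `|y| ^+ 2.
Proof.
move=> hip x y; have [sym _ nrm] := hip.
rewrite (sqr_normD hip) normrN sym -scaleN1r.
by rewrite (inner_productZl hip) (sym y); ring.
Qed.

(** Polarization writes [ip x v] through the continuous quantities |x + v| and |x|. *)
Lemma inner_product_continuous (R : realType) (H : normedModType R)
    (ip : H -> H -> R) (v : H) :
  is_inner_product ip -> continuous (ip^~ v).
Proof.
move=> hip x.
have -> : ip^~ v = fun x => 2^-1 * (`|x + v| ^+ 2 - `|x| ^+ 2 - `|v| ^+ 2).
  by apply: funext => u; rewrite (sqr_normD hip); field.
apply: cvgM; first exact: cvg_cst.
apply: cvgB; last exact: cvg_cst.
have sq (h : H -> R) : h u @[u --> x] --> h x -> h u ^+ 2 @[u --> x] --> h x ^+ 2.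
  by move=> hc; under eq_fun do rewrite expr2; rewrite expr2; exact: cvgM.
apply: cvgB; apply: sq; last exact: cvg_norm.
by apply: cvg_norm; apply: cvgD; [exact: cvg_id | exact: cvg_cst].
Qed.

Lemma inner_product_convex (R : realType) (H : normedModType R)
    (ip : H -> H -> R) (v : H) (c : R) :
  is_inner_product ip -> convex_fun (fun x => c * ip x v).
Proof.
move=> hip t x y _ _.
rewrite (inner_productDl hip) !(inner_productZl hip).
by rewrite le_eqVlt; apply/orP; left; apply/eqP; ring.
Qed.

(** * First-order expansion and the convex gradient inequality *)

Lemma gradient_near (R : realType) (H : normedModType R) (ip : H -> H -> R)
    (f : H -> R) (g : H -> H) (x v : H) (e : R) :
  is_gradient ip f g -> 0 < e ->
  exists2 d, 0 < d & forall t, 0 < t -> t < d ->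
    `|f (t *: v + x) - f x - t * ip (g x) v| <= e * t.
Proof.
move=> hg e0; have [df gE] := hg x.
have : (fun h : R => h^-1 *: ((f \o shift x) (h *: v) - f x)) @ 0^' --> ip (g x) v.
  by rewrite -gE -deriveE//; exact: diff_derivable.
move=> /cvgrPdist_le /(_ e e0) [d /= d0 hd]; exists d => // t t0 td.
have /= := hd t.
rewrite sub0r normrN gtr0_norm// => /(_ td (lt0r_neq0 t0)).
have -> : f (t *: v + x) - f x - t * ip (g x) v =
    - ((ip (g x) v - t^-1 * (f (t *: v + x) - f x)) * t).
  by field; rewrite gt_eqF.
by rewrite normrN normrM (gtr0_norm t0) ler_pM2r.
Qed.

(** Convexity on the segment bounds the increment of [f] by [t * (f y - f x)]; comparing with the
    first-order expansion and dividing by [t] leaves only the arbitrary error [e]. *)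
Lemma gradient_ineq (R : realType) (H : normedModType R) (ip : H -> H -> R)
    (f : H -> R) (g : H -> H) :
  convex_fun f -> is_gradient ip f g ->
  forall x y, f x + ip (g x) (y - x) <= f y.
Proof.
move=> cf hg x y; apply/ler_addgt0Pr => e e0.
have [d d0 hd] := gradient_near x (y - x) hg e0.
pose t := Num.min (d / 2) 1.
have t0 : 0 < t by rewrite lt_min ltr01 divr_gt0.
have t1 : t <= 1 by rewrite ge_min lexx orbT.
have td : t < d by rewrite gt_min ltr_pdivrMr// ltr_pMr// ltr1n.
have := hd t t0 td; rewrite ler_norml => /andP[+ _].
have -> : t *: (y - x) + x = t *: y + (1 - t) *: x.
  by rewrite scalerBr scalerBl scale1r -addrA; congr (_ + _); rewrite addrC.
have := cf t y x (ltW t0) t1 => h1 h2.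
rewrite -(ler_pM2l t0); lra.
Qed.

(** * Estimates for a single proximal step *)

(** Fermat's rule: [w] is the gradient at [z] of the proximal objective, and a small move along
    [- w] would lower that objective if [w] were nonzero. *)
Lemma prox_eq (R : realType) (H : normedModType R) (ip : H -> H -> R)
    (f : H -> R) (g : H -> H) (lam : R) (y z : H) :
  is_inner_product ip -> is_gradient ip f g -> 0 < lam ->
  is_prox f lam y z -> z = y - lam *: g z.
Proof.
move=> hip hg l0 hz; have [sym _ nrm] := hip.
pose w := g z + lam^-1 *: (z - y).
suff /eqP w0 : w == 0.
  have : lam *: w = lam *: g z + (z - y).
    by rewrite scalerDr scalerA divff ?gt_eqF// scale1r.
  rewrite w0 scaler0 addrCA => /esym/eqP; rewrite addr_eq0 => /eqP {1}->.
  by rewrite opprB.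
rewrite -normr_eq0 -sqrf_eq0 eq_le sqr_ge0 andbT.
apply/ler_addgt0Pr => e e0; rewrite add0r.
have e20 : 0 < e / 2 by rewrite divr_gt0.
have [d d0 hd] := gradient_near z (- w) hg e20.
(* With [t <= lam] the quadratic term costs at most half of the decrease t |w|^2, so minimality
   leaves |w|^2 <= e. *)
pose t := Num.min (d / 2) lam.
have t0 : 0 < t by rewrite lt_min l0 divr_gt0.
have tl : t <= lam by rewrite ge_min lexx orbT.
have td : t < d by rewrite gt_min ltr_pdivrMr// ltr_pMr// ltr1n.
have := hd t t0 td; rewrite ler_norml => /andP[_ h1].
have := hz (t *: (- w) + z); rewrite -addrA.
have ipN a u v : ip u (a *: v) = a * ip u v.
  by rewrite sym (inner_productZl hip) sym.
rewrite (sqr_normD hip (t *: - w)) scalerN -scaleNr normrZ sym ipN exprMn.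
rewrite real_normK ?num_real// sqrrN.
move: h1; rewrite -scaleN1r ipN scalerA mulrN1.
have : `|w| ^+ 2 = ip (g z) w + lam^-1 * ip (z - y) w.
  by rewrite -nrm {1}/w (inner_productDl hip) (inner_productZl hip).
have -> : (2 * lam)^-1 = lam^-1 / 2 by rewrite invfM mulrC.
have tl' : t * lam^-1 <= 1 by rewrite ler_pdivrMr// mul1r.
set W := `|w| ^+ 2; set D := `|z - y| ^+ 2; set i1 := ip _ w; set i2 := ip _ w.
move=> wE h1 h2.
have W0 : 0 <= W by exact: sqr_ge0.
have h3 : t * (t * lam^-1 * W) <= t * W by rewrite ler_pM2l// ler_piMl.
rewrite -(ler_pM2l t0); move: h1 h2 h3; rewrite wE.
set F := f _; set l := lam^-1; lra.
Qed.

Lemma prox_step_decrease (R : realType) (H : normedModType R)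
    (ip : H -> H -> R) (f : H -> R) (g : H -> H) (lam : R) (y z : H) :
  is_inner_product ip -> convex_fun f -> is_gradient ip f g ->
  z = y - lam *: g z -> f z + lam * `|g z| ^+ 2 <= f y.
Proof.
move=> hip cf hg zE; have [sym _ nrm] := hip.
have := gradient_ineq cf hg z y.
have -> : y - z = lam *: g z by rewrite {1}zE subKr.
by rewrite sym (inner_productZl hip) nrm.
Qed.

(** Adding the gradient inequalities at [y] and [z] gives |g z|^2 <= ip (g z) (g y); nonnegativity
    of |g z - g y|^2 then does the work of Cauchy-Schwarz. *)
Lemma prox_step_gradient (R : realType) (H : normedModType R)
    (ip : H -> H -> R) (f : H -> R) (g : H -> H) (lam : R) (y z : H) :
  is_inner_product ip -> convex_fun f -> is_gradient ip f g -> 0 < lam ->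
  z = y - lam *: g z -> `|g z| <= `|g y|.
Proof.
move=> hip cf hg l0 zE; have [sym _ nrm] := hip.
have h1 := gradient_ineq cf hg z y.
have h2 := gradient_ineq cf hg y z.
have yz : y - z = lam *: g z by rewrite {1}zE subKr.
have zy : z - y = (- lam) *: g z by rewrite -opprB yz scaleNr.
move: h1 h2; rewrite yz zy ![ip _ (_ *: _)]sym !(inner_productZl hip) nrm.
move=> h1 h2; have : lam * `|g z| ^+ 2 <= lam * ip (g z) (g y) by lra.
rewrite ler_pM2l// => h3.
rewrite -ler_sqr ?nnegrE ?normr_ge0//.
have := sqr_normB hip (g z) (g y); have := sqr_ge0 `|g z - g y|; lra.
Qed.

(** In the expansion of the square of [y - x = (z - x) + lam *: g z], the gradient inequality at [z]
    bounds the cross term from below. *)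
Lemma prox_step_fejer (R : realType) (H : normedModType R)
    (ip : H -> H -> R) (f : H -> R) (g : H -> H) (lam : R) (x y z : H) :
  is_inner_product ip -> convex_fun f -> is_gradient ip f g -> 0 < lam ->
  z = y - lam *: g z ->
  2 * lam * (f z - f x) + lam ^+ 2 * `|g z| ^+ 2 + `|z - x| ^+ 2
    <= `|y - x| ^+ 2.
Proof.
move=> hip cf hg l0 zE; have [sym _ nrm] := hip.
have yE : y - x = (z - x) + lam *: g z by rewrite {1}zE addrAC subrK.
rewrite yE (sqr_normD hip (z - x) (lam *: g z)) (sym (z - x)) (inner_productZl hip).
rewrite normrZ exprMn real_normK ?num_real//.
have := gradient_ineq cf hg z x.
have -> : ip (g z) (x - z) = - ip (g z) (z - x).
  by rewrite -opprB -scaleN1r sym (inner_productZl hip) sym mulN1r.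
move=> h; have : lam * (f z - f x) <= lam * ip (g z) (z - x).
  by rewrite ler_pM2l//; lra.
lra.
Qed.

(** * Decay of real sequences *)

(** [F], [G], [d] model the value gap, the gradient norm and a squared distance. From k to k + 1 the
    square grows by at most (2k + 1) l^2 G(k+1)^2: the decrease of [F], weighted by 2kl, absorbs 2k
    of these units, and the decrease of [d] absorbs the last one together with 2l F(k+1). *)
Lemma prox_energy (R : realType) (l : R) (lam F G d : nat -> R) :
  0 < l -> (forall k, l <= lam k) -> (forall k, 0 <= F k) ->
  (forall k, 0 <= G k) -> (forall k, G k.+1 <= G k) ->
  (forall k, F k.+1 + lam k * G k.+1 ^+ 2 <= F k) ->
  (forall k, 2 * lam k * F k.+1 + lam k ^+ 2 * G k.+1 ^+ 2 + d k.+1 <= d k) ->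
  forall k, d k + 2 * k%:R * l * F k + (k%:R * l * G k) ^+ 2 <= d 0%N.
Proof.
move=> l0 hl F0 G0 hG hF hd; elim=> [|k IH].
  by rewrite mulr0n mulr0 !mul0r expr0n /= !addr0.
apply: le_trans IH; rewrite -natr1.
have hl' := hl k; have hd' := hd k; have hF' := hF k.
have k0 : 0 <= k%:R :> R by exact: ler0n.
set K := k%:R in k0 *.
have F1 := F0 k.+1.
have s1 : 0 <= G k.+1 ^+ 2 by exact: sqr_ge0.
have s2 : G k.+1 ^+ 2 <= G k ^+ 2 by rewrite ler_sqr ?nnegrE.
have e1 : l * F k.+1 <= lam k * F k.+1 by rewrite ler_wpM2r.
have e2 : l * G k.+1 ^+ 2 <= lam k * G k.+1 ^+ 2 by rewrite ler_wpM2r.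
have e3 : l ^+ 2 * G k.+1 ^+ 2 <= lam k ^+ 2 * G k.+1 ^+ 2.
  by rewrite ler_wpM2r// ler_sqr ?nnegrE ?(le_trans (ltW l0))// ltW.
have e4 : K * l * (F k.+1 + l * G k.+1 ^+ 2) <= K * l * F k.
  by rewrite ler_wpM2l ?mulr_ge0 ?(ltW l0)//; lra.
have e5 : (K * l) ^+ 2 * G k.+1 ^+ 2 <= (K * l) ^+ 2 * G k ^+ 2.
  by rewrite ler_wpM2l ?sqr_ge0.
rewrite !exprMn; move: e3 e4 e5; rewrite !exprMn.
set G1 := G k.+1 ^+ 2 in s1 s2 e2 hd' hF' *; set Fk := F k.+1 in hd' hF' F1 e1 *.
move=> e3 e4 e5; lra.
Qed.

(** The last hypothesis is telescoped over m <= k < m + n, where k^a >= m^a and F(k+1) >= F(m+n). *)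
Lemma block_sum_bound (R : realType) (a c : R) (F d : nat -> R) :
  0 <= a -> 0 < c -> (forall k, 0 <= F k) -> (forall k, F k.+1 <= F k) ->
  (forall k, c * k%:R `^ a * F k.+1 <= d k - d k.+1) ->
  forall m n, n%:R * c * m%:R `^ a * F (m + n)%N <= d m - d (m + n)%N.
Proof.
move=> a0 c0 F0 Fd hd m; elim=> [|n IH].
  by rewrite mulr0n !mul0r addn0 subrr.
rewrite addnS -natr1.
have := hd (m + n)%N; have := Fd (m + n)%N; have := F0 (m + n).+1.
have : m%:R `^ a <= (m + n)%:R `^ a.
  by rewrite ge0_ler_powR ?nnegrE ?ler0n// ler_nat leq_addr.
have P0 : 0 <= m%:R `^ a by exact: powR_ge0.
set P := m%:R `^ a in P0 IH *; set Q := (m + n)%:R `^ a.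
set F1 := F (m + n).+1; set F2 := F (m + n)%N in IH *.
move=> PQ F10 F12 hQ.
have h1 : c * P * F1 <= c * Q * F1 by rewrite ler_wpM2r// ler_wpM2l// ltW.
have h2 : n%:R * c * P * F1 <= n%:R * c * P * F2.
  by rewrite ler_wpM2l// !mulr_ge0// ltW.
lra.
Qed.

(** [d] converges, so its drop over [m, 2m) tends to zero, while the block bound makes this drop at
    least c m^(1+a) F(2m). *)
Lemma nonincreasing_rate (R : realType) (a c : R) (F d : nat -> R) :
  0 <= a -> 0 < c -> (forall k, 0 <= F k) -> (forall k, F k.+1 <= F k) ->
  (forall k, 0 <= d k) ->
  (forall k, c * k%:R `^ a * F k.+1 <= d k - d k.+1) ->
  forall e, 0 < e -> \forall k \near \oo, F k.+1 <= e * k%:R `^ (- (1 + a)).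
Proof.
move=> a0 c0 F0 Fd d0 hd e e0.
have dd : {homo d : n m / (n <= m)%N >-> m <= n}.
  apply/nonincreasing_seqP => k; rewrite -subr_ge0; apply: le_trans (hd k).
  by rewrite !mulr_ge0// ?ltW// powR_ge0.
have FdP : {homo F : n m / (n <= m)%N >-> m <= n} by apply/nonincreasing_seqP.
have dlb : has_lbound (range d) by exists 0 => _ [k _ <-].
have hc := nonincreasing_cvgn dd dlb; set s := inf _ in hc.
have ds n : s <= d n by apply: ge_inf => //; exists n.
(* [P2] is the price of passing from m to k <= 2m in the power 1 + a. *)
pose P2 := (2 : R) `^ (1 + a).
have P20 : 0 < P2 by rewrite powR_gt0.
pose e' := e * c / P2.
have e'0 : 0 < e' by rewrite divr_gt0// mulr_gt0.
have [N _ hN] := (cvgrPdist_le _ _).1 hc e' e'0.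
exists (N.*2.+1)%N => // k /= Nk.
(* This rounding gives k <= 2m <= k + 1: the first inequality compares the powers, the second yields
   F(k+1) <= F(2m). *)
pose m := (k.+1)./2.
have km : (k <= m + m)%N by lia.
have mk : (m + m <= k.+1)%N by lia.
have Nm : (N <= m)%N by lia.
have k1 : (0 < k)%N by exact: leq_trans Nk.
have := hN m Nm; rewrite /= distrC ger0_norm ?subr_ge0// => hm.
have := block_sum_bound a0 c0 F0 Fd hd m m.
have := ds (m + m)%N; have := FdP _ _ mk; set F2 := F (m + m)%N.
move=> FF sd hb.
have kR : 0 < k%:R :> R by rewrite ltr0n.
rewrite powRN ler_pdivlMr ?powR_gt0//.
have m1 : (0 < m)%N by lia.
have mP : m%:R * m%:R `^ a = m%:R `^ (1 + a) :> R.
  by rewrite powRD ?powRr1 ?ler0n// pnatr_eq0 -lt0n m1 implybT.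
have kP : k%:R `^ (1 + a) <= P2 * m%:R `^ (1 + a).
  rewrite -powRM ?ler0n// ge0_ler_powR ?nnegrE ?mulr_ge0 ?ler0n ?addr_ge0//.
  by rewrite -natrM ler_nat mul2n -addnn.
have hb' : c * (m%:R `^ (1 + a) * F2) <= e' by rewrite -mP; lra.
have F20 : 0 <= F2 := F0 _.
apply: (@le_trans _ _ (F2 * (P2 * m%:R `^ (1 + a)))).
  by apply: ler_pM => //; exact: powR_ge0.
rewrite -(ler_pM2l c0) [leRHS]mulrC -(divfK (lt0r_neq0 P20) (e * c)) -/e'.
rewrite [leLHS](_ : _ = c * (m%:R `^ (1 + a) * F2) * P2); last by ring.
by rewrite ler_pM2r.
Qed.

(** * Convex clusters and Opial's argument *)

(* Plays the role of a weak cluster point of [(y k)] along the index set [A]: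
   [x] lies in every closed convex hull of a tail. *)
Definition convex_cluster (R : realType) (H : normedModType R)
    (A : set nat) (y : nat -> H) (x : H) : Prop :=
  forall (h : H -> R) (c : R) (n : nat), convex_fun h -> continuous h ->
    (forall k, (n <= k)%N -> A k -> h (y k) <= c) -> h x <= c.

Lemma convex_clusterS (R : realType) (H : normedModType R) (A B : set nat)
    (y : nat -> H) (x : H) :
  A `<=` B -> convex_cluster A y x -> convex_cluster B y x.
Proof.
by move=> AB hx h c n ch hh hy; apply: (hx h c n) => // k nk /AB; exact: hy.
Qed.

(* The limit of near-minimal-norm elements of the convex hulls of the tails,
   which form a Cauchy sequence by the parallelogram law. *)
Lemma convex_cluster_exists (R : realType) (H : completeNormedModType R)
    (ip : H -> H -> R) (A : set nat) (y : nat -> H) (M : R) :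
  is_inner_product ip -> (forall k, `|y k| <= M) ->
  (forall n, exists2 k, (n <= k)%N & A k) ->
  exists x, convex_cluster A y x.
Proof.
move=> hip yM hA.
(* Stand-in for the convex hull of a tail: [z] inherits every upper bound that a convex function
   satisfies on the tail, so stability under midpoints is immediate. *)
pose hull n (z : H) := forall (h : H -> R) (c : R), convex_fun h ->
  (forall k, (n <= k)%N -> A k -> h (y k) <= c) -> h z <= c.
have hullS n m z : (n <= m)%N -> hull m z -> hull n z.
  by move=> nm hz h c ch hy; apply: hz => // k mk; apply: hy; exact: leq_trans mk.
have hull_mid n z z' : hull n z -> hull n z' -> hull n (2^-1 *: (z + z')).
  move=> hz hz' h c ch hy.
  have := ch 2^-1 z z'; have := hz h c ch hy; have := hz' h c ch hy.
  have -> : 1 - 2^-1 = 2^-1 :> R by field.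
  rewrite -scalerDr => h1 h2 /(_ _ _)/le_trans; apply; lra.
pose E n : set R := [set `|z| ^+ 2 | z in hull n].
have E0 n : lbound (E n) 0 by move=> _ [z _ <-]; exact: sqr_ge0.
have Elb n : has_lbound (E n) by exists 0.
have Eex n : exists2 k, (n <= k)%N & hull n (y k).
  by have [k nk Ak] := hA n; exists k => // h c _; apply.
have Einf n : has_inf (E n).
  by split => //; have [k _ hk] := Eex n; exists (`|y k| ^+ 2), (y k).
(* Squared distance from the origin to the [n]-th hull; it is nondecreasing and bounded by M^2. *)
pose d n := inf (E n).
have dM n : d n <= M ^+ 2.
  have [k _ hk] := Eex n.
  apply: (@le_trans _ _ (`|y k| ^+ 2)); first by apply: ge_inf => //; exists (y k).
  by rewrite ler_sqr ?nnegrE//; exact: le_trans (yM 0%N).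
have dle n m : (n <= m)%N -> d n <= d m.
  move=> nm; apply: lb_le_inf; first by case: (Einf m).
  by move=> _ [z hz <-]; apply: ge_inf => //; exists z => //; exact: hullS hz.
have dsup : has_sup (range d).
  by split; [exists (d 0%N), 0%N | exists (M ^+ 2) => _ [n _ <-]].
have /choice[z hz] n : exists z, hull n z /\ `|z| ^+ 2 < d n + n.+1%:R^-1.
  have n0 : 0 < n.+1%:R^-1 :> R by rewrite invr_gt0 ltr0n.
  by have [_ [z hz <-] lt] := inf_adherent n0 (Einf n); exists z.
have zc : cauchy (z @ \oo).
  apply: cauchy_exP => e e0.
  (* The parallelogram law bounds |z N - z n|^2 by 2 (d n - d N) + 4 eta, and d n - d N < eta, for a
     total of 6 eta. *)
  pose eta := e ^+ 2 / 6.
  have eta0 : 0 < eta by rewrite divr_gt0// exprn_gt0.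
  have [s ds [N1 hN1]] : exists2 s, forall n, d n <= s & exists n, s - eta < d n.
    exists (sup (range d)); first by move=> n; apply: sup_upper_bound => //; exists n.
    by have [_ [N1 _ <-] hN1] := sup_adherent eta0 dsup; exists N1.
  have [N2 _ hN2] := near_infty_natSinv_lt (PosNum eta0).
  pose N := maxn N1 N2.
  exists (z N); exists N => // n /= Nn.
  rewrite -ball_normE /= -ltr_sqr ?nnegrE// ?(ltW e0)//.
  have [hzN ltN] := hz N; have [hzn ltn] := hz n.
  have dn := ds n.
  have dN : d N1 <= d N by apply: dle; exact: leq_maxl.
  have : n.+1%:R^-1 < eta by apply: hN2; apply: leq_trans Nn; exact: leq_maxr.
  have : N.+1%:R^-1 < eta by apply: hN2; exact: leq_maxr.
  have : d N <= `|2^-1 *: (z N + z n)| ^+ 2.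
    apply: ge_inf => //; exists (2^-1 *: (z N + z n)) => //.
    by apply: hull_mid => //; exact: hullS hzn.
  rewrite normrZ exprMn (sqr_normD hip) (sqr_normB hip).
  rewrite ger0_norm ?invr_ge0//.
  have : eta * 6 = e ^+ 2 by rewrite /eta divfK.
  move: hN1 ltN ltn dn dN.
  move: (d N1) (d N) (d n) (`|z N| ^+ 2) (`|z n| ^+ 2) N.+1%:R^-1 n.+1%:R^-1 (ip _ _).
  by move=> *; lra.
have /cvg_ex[x zx] : cvg (z @ \oo) by exact: cauchy_cvg.
exists x => h c n ch hc hy.
have : h (z m) @[m --> \oo] --> h x by apply: continuous_cvg => //; exact: hc.
apply: (closed_cvg (fun t : R => t <= c)); first exact: closed_le.
exists n => // m /= nm; have [hzm _] := hz m.
exact: (hullS _ _ _ nm hzm).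
Qed.

Lemma convex_cluster_inner (R : realType) (H : normedModType R)
    (ip : H -> H -> R) (A : set nat) (y : nat -> H) (x v : H) (c : R) (n : nat) :
  is_inner_product ip -> convex_cluster A y x ->
  (forall k, (n <= k)%N -> A k -> ip (y k) v <= c) -> ip x v <= c.
Proof.
(* The factor 1 puts the functional in the form covered by [inner_product_convex]. *)
move=> hip hx hy; rewrite -[ip x v]mul1r.
apply: (hx (fun x => 1 * ip x v) c n); first exact: inner_product_convex.
  by move=> u; apply: cvgM; [exact: cvg_cst | exact: inner_product_continuous].
by move=> k nk Ak; rewrite mul1r; exact: hy.
Qed.

(** Testing with [v] and with its opposite transfers the eventual bounds on both sides of [l] to
    [x]. *)
Lemma convex_cluster_inner_lim (R : realType) (H : normedModType R)
    (ip : H -> H -> R) (y : nat -> H) (x v : H) (l : R) :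
  is_inner_product ip -> convex_cluster setT y x ->
  (fun k => ip (y k) v) @ \oo --> l -> ip x v = l.
Proof.
move=> hip hx hl; have [sym _ _] := hip.
apply/eqP; rewrite eq_le; apply/andP; split; apply/ler_addgt0Pr => e e0;
  have [n _ hn] := (cvgrPdist_le _ _).1 hl e e0.
- apply: (convex_cluster_inner (n := n) hip hx) => k nk _.
  by have /= := hn k nk; rewrite ler_norml; lra.
- have ipN u : ip u ((-1) *: v) = - ip u v.
    by rewrite sym (inner_productZl hip) sym mulN1r.
  have : ip x ((-1) *: v) <= e - l; last by rewrite ipN; lra.
  apply: (convex_cluster_inner (n := n) hip hx) => k nk _.
  by rewrite ipN; have /= := hn k nk; rewrite ler_norml; lra.
Qed.

(** If weak convergence to the cluster [x] failed, the offending indices would carry a second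
    cluster [x'] separated from [x]. Both lie in [S], so the two distances converge, hence so does
    [ip (y k) (x - x')], and this forces [x = x']. *)
Lemma opial (R : realType) (H : completeNormedModType R) (ip : H -> H -> R)
    (y : nat -> H) (S : set H) (M : R) :
  is_inner_product ip -> (forall k, `|y k| <= M) ->
  (forall x, S x -> cvgn (fun k => `|y k - x| ^+ 2)) ->
  (forall x, convex_cluster setT y x -> S x) ->
  exists2 x, S x & forall v, (fun k => ip (y k) v) @ \oo --> ip x v.
Proof.
move=> hip yM hS clS; have [sym _ nrm] := hip.
have [x hx] : exists x, convex_cluster setT y x.
  by apply: (convex_cluster_exists hip yM) => n; exists n.
exists x; first exact: clS.
have ipN u v : ip u (- v) = - ip u v.
  by rewrite -scaleN1r sym (inner_productZl hip) sym mulN1r.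
suff key v e : 0 < e -> \forall k \near \oo, ip (y k) v <= ip x v + e.
  move=> v; apply/cvgrPdist_le => e e0.
  have [n1 _ h1] := key v e e0; have [n2 _ h2] := key (- v) e e0.
  exists (maxn n1 n2) => // k /=; rewrite geq_max => /andP[k1 k2].
  have /= := h1 k k1; have /= := h2 k k2; rewrite !ipN ler_norml; lra.
move=> e0; apply: contrapT => hne.
pose A : set nat := [set k | ip x v + e < ip (y k) v].
have hA n : exists2 k, (n <= k)%N & A k.
  apply: contrapT => hn; apply: hne; exists n => // k /= nk.
  by rewrite leNgt; apply/negP => kA; apply: hn; exists k.
have [x' hx'] := convex_cluster_exists hip yM hA.
have hx'T : convex_cluster setT y x' by apply: convex_clusterS hx'.
have xv : ip x v + e <= ip x' v.
  have : ip x' (- v) <= - (ip x v + e); last by rewrite ipN; lra.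
  apply: (convex_cluster_inner (n := 0%N) hip hx') => k _ /ltW.
  by rewrite ipN; lra.
have /cvg_ex[l1 cx] := hS _ (clS _ hx).
have /cvg_ex[l2 cx'] := hS _ (clS _ hx'T).
have cu : (fun k => ip (y k) (x - x')) @ \oo -->
    2^-1 * (l2 - l1 - (`|x'| ^+ 2 - `|x| ^+ 2)).
  have -> : (fun k => ip (y k) (x - x')) = fun k =>
      2^-1 * (`|y k - x'| ^+ 2 - `|y k - x| ^+ 2 - (`|x'| ^+ 2 - `|x| ^+ 2)).
    apply: funext => k; rewrite !(sqr_normB hip).
    by rewrite (sym (y k) (x - x')) (inner_productBl hip) !(sym (y k)); field.
  apply: cvgM; first exact: cvg_cst.
  by apply: cvgB; [exact: cvgB | exact: cvg_cst].
(* Both clusters pair with [x - x'] to the same limit, so |x - x'|^2 = 0. *)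
have xx' : x - x' = 0.
  apply/eqP; rewrite -normr_eq0 -sqrf_eq0 -nrm (inner_productBl hip).
  rewrite (convex_cluster_inner_lim hip hx cu).
  by rewrite (convex_cluster_inner_lim hip hx'T cu) subrr.
by move/eqP: xx'; rewrite subr_eq0 => /eqP xx'; move: xv; rewrite xx'; lra.
Qed.

(** * Minimum value, convergence rate and weak limit of the iterates *)

Lemma inf_range_argmin (R : realType) (H : normedModType R) (f : H -> R) (x : H) :
  is_argmin f x -> inf (range f) = f x.
Proof.
move=> hx; apply/eqP; rewrite eq_le; apply/andP; split.
  by apply: ge_inf; [exists (f x) => _ [u _ <-] | exists x].
by apply: lb_le_inf; [exists (f x), x | move=> _ [u _ <-]].
Qed.

Theorem mainTheorem14 (R : realType) (H : completeNormedModType R)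
    (ip : H -> H -> R) (f : H -> R) (g : H -> H) (p : R) (y : nat -> H) :
  is_inner_product ip ->
  convex_fun f ->
  is_gradient ip f g ->
  continuous g ->
  (exists x, is_argmin f x) ->
  lipschitz_on_bounded g ->
  1 <= p ->
  (forall k, g (y k) != 0) ->
  (forall k, is_prox f (`|g (y k)| `^ (- ((p - 1) / p))) (y k) (y k.+1)) ->
  (fun k : nat => f (y k.+1) - inf (range f))
     =o_\oo (fun k : nat => k%:R `^ (- (2 - p^-1))) /\
  exists2 x, is_argmin f x & forall v, (fun k => ip (y k) v) @ \oo --> ip x v.
Proof.
move=> hip cf hg _ [x0 hx0] _ p1 gn0 hprox.
have p0 : 0 < p by exact: lt_le_trans p1.
set a := (p - 1) / p in hprox.
have a0 : 0 <= a by rewrite divr_ge0 ?subr_ge0// ltW.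
have aE : 1 + a = 2 - p^-1 by rewrite /a; field; rewrite gt_eqF.
pose G k := `|g (y k)|.
pose lam k := G k `^ (- a).
have G0 k : 0 < G k by rewrite normr_gt0.
have lam0 k : 0 < lam k by rewrite powR_gt0.
have step k : y k.+1 = y k - lam k *: g (y k.+1).
  exact: prox_eq hip hg (lam0 k) (hprox k).
have Gd k : G k.+1 <= G k.
  exact: prox_step_gradient hip cf hg (lam0 k) (step k).
have GdP : {homo G : n m / (n <= m)%N >-> m <= n} by apply/nonincreasing_seqP.
(* [G] is nonincreasing and the exponent [- a] is nonpositive. *)
have laml k : lam 0%N <= lam k.
  rewrite /lam !powRN lef_pV2 ?posrE ?powR_gt0//.
  by rewrite ge0_ler_powR ?nnegrE ?(ltW (G0 _))//; exact: GdP.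
pose F k := f (y k) - f x0.
have F0 k : 0 <= F k by rewrite subr_ge0.
have hF k : F k.+1 + lam k * G k.+1 ^+ 2 <= F k.
  by have := prox_step_decrease hip cf hg (step k); rewrite /F /G; lra.
have Fd k : F k.+1 <= F k.
  by apply: le_trans (hF k); rewrite lerDl mulr_ge0 ?sqr_ge0// ltW.
have hd x k : 2 * lam k * (f (y k.+1) - f x) + lam k ^+ 2 * G k.+1 ^+ 2 +
    `|y k.+1 - x| ^+ 2 <= `|y k - x| ^+ 2.
  exact: prox_step_fejer hip cf hg (lam0 k) (step k).
have fejer x : is_argmin f x ->
    {homo (fun k => `|y k - x| ^+ 2) : n m / (n <= m)%N >-> m <= n}.
  move=> hx; apply/nonincreasing_seqP => k; apply: le_trans (hd x k).
  have := ltW (lam0 k); have := hx (y k.+1) => h1 h2.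
  rewrite lerDr addr_ge0//; last by rewrite mulr_ge0// sqr_ge0.
  by rewrite !mulr_ge0// subr_ge0.
pose d k : R := `|y k - x0| ^+ 2.
have energy := prox_energy (lam0 0%N) laml F0
  (fun k => ltW (G0 k)) Gd hF (hd x0) : forall k, _ <= d 0%N.
set l := lam 0%N in laml energy.
have l0 : 0 < l := lam0 0%N.
split.
(* The [+ 1] makes [B] positive at once, so that dividing by it is safe. *)
- pose B := `|y 0%N - x0| + 1.
  have B0 : 0 < B by rewrite ltr_wpDl.
  (* The energy gives k l G(k) <= B, whence lam(k) = G(k)^(-a) >= (k l / B)^a = c k^a. *)
  pose c := (l / B) `^ a.
  have c0 : 0 < c by rewrite powR_gt0// divr_gt0.
  have lamk k : c * k%:R `^ a <= lam k.
    have lB : 0 <= l / B by rewrite divr_ge0// ltW.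
    have lBk : 0 <= l / B * k%:R by rewrite mulr_ge0.
    have lBkG : 0 <= l / B * k%:R * G k by rewrite mulr_ge0// ltW.
    have klG : k%:R * l * G k <= B.
      apply: (@le_trans _ _ `|y 0%N - x0|); last by rewrite lerDl.
      have klG0 : 0 <= k%:R * l * G k by rewrite !mulr_ge0// ltW.
      rewrite -ler_sqr ?nnegrE//.
      apply: le_trans (energy k); rewrite lerDr addr_ge0 ?sqr_ge0//.
      by rewrite !mulr_ge0// ltW.
    rewrite /lam powRN -div1r ler_pdivlMr ?powR_gt0// /c.
    rewrite -powRM// -powRM ?(ltW (G0 k))//.
    rewrite [leRHS](_ : 1 = 1 `^ a); last by rewrite powR1.
    apply: ge0_ler_powR; rewrite ?nnegrE//.
    by rewrite (mulrAC l) (mulrAC _ B^-1) (mulrC l) ler_pdivrMr// mul1r.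
  have rate := nonincreasing_rate (d := d) a0 c0 F0 Fd (fun k => sqr_ge0 _).
  rewrite (inf_range_argmin hx0); apply/eqoP => e e0.
  have [k|n _ hn] := rate _ e e0.
    have := hd x0 k; rewrite -/(F k.+1) -/(d k) -/(d k.+1).
    have : c * k%:R `^ a * F k.+1 <= lam k * F k.+1 by rewrite ler_wpM2r.
    have : 0 <= lam k * F k.+1 by rewrite mulr_ge0// ltW.
    have : 0 <= lam k ^+ 2 * G k.+1 ^+ 2 by rewrite mulr_ge0 ?sqr_ge0.
    lra.
  exists n => // k nk; have /= := hn k nk.
  by rewrite -aE (ger0_norm (F0 k.+1)) (ger0_norm (powR_ge0 _ _)).
- have bnd k : `|y k| <= `|y 0%N - x0| + `|x0|.
    rewrite -{1}[y k](subrK x0) (le_trans (ler_normD _ _))// lerD2r.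
    by rewrite -ler_sqr ?nnegrE//; exact: fejer.
  apply: (opial (S := is_argmin f) hip bnd) => x hx.
    apply: nonincreasing_is_cvgn; first exact: fejer.
    by exists 0 => _ [k _ <-]; exact: sqr_ge0.
  (* A cluster is a minimizer: [f] itself serves as the test function, and the energy gives 2 k l
     F(k) <= d(0), so F(k) <= e once k l e >= d(0), which [n] ensures. *)
  move=> u; apply: le_trans (hx0 u); apply/ler_addgt0Pr => e e0.
  pose n := (Num.truncn (d 0%N / (l * e))).+1.
  apply: (hx f _ n) => //.
    by move=> z; apply: differentiable_continuous; case: (hg z).
  move=> k nk _; rewrite addrC -lerBlDr -/(F k).
  have k0 : 0 < k%:R :> R by rewrite ltr0n (leq_trans _ nk).
  have kd : d 0%N <= k%:R * (l * e).
    rewrite -ler_pdivrMr ?mulr_gt0//.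
    apply: (@le_trans _ _ n%:R); last by rewrite ler_nat.
    by apply/ltW; exact: truncnS_gt.
  rewrite -(ler_pM2l (mulr_gt0 k0 l0)); have := energy k.
  have : 0 <= d k by exact: sqr_ge0.
  have : 0 <= (k%:R * l * G k) ^+ 2 by exact: sqr_ge0.
  have : 0 <= k%:R * l * F k by rewrite !mulr_ge0 ?(ltW l0).
  rewrite -/(d k); lra.
Qed.
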